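(* Let $m_1,m_2$ be positive real numbers with $m_1\leq 1.8m_2$, and let $\beta$ be the real root in the interval $[0.5,1)$ of the polynomial $2m_2(1-x)(1+x)^2-m_1x(2+x)$. Let $G\in \mathcal{G}_{m_1,m_2}$. If \[\Delta(G)\geq \frac{2}{1-\beta}m_1,\] then $G$ has an equitable $r$-coloring for every integer $r\geq \Delta(G)$.
   Context: All graphs are finite and simple. For a graph $H$, $|H|$ denotes its number of vertices and $\lVert H\rVert$ its number of edges; $\Delta(G)$ is the maximum degree of $G$. For real numbers $m_1,m_2$, $\mathcal{G}_{m_1,m_2}$ is the class of graphs $G$ such that $\lVert H\rVert\leq m_1|H|$ for every subgraph $H$ of $G$, and $\lVert H\rVert\leq m_2|H|$ for every bipartite subgraph $H$ of $G$. An equitable $r$-coloring of a graph is a partition of its vertex set into $r$ independent sets $V_1,\dots,V_r$ (some possibly empty) with $\big||V_i|-|V_j|\big|\leq 1$ for all $i,j$. When $m_1\le 1.8m_2$, the function $\frac{2(1-x)(1+x)^2}{x(x+2)}$ is decreasing on $[0.5,1)$ from $1.8$ to $0$, so the root $\beta\in[0.5,1)$ exists and is unique. *)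

(* Defs.v *)
From HB Require Import structures.
From mathcomp Require Import all_boot all_order all_algebra.
From mathcomp Require Import reals.
Set Implicit Arguments. Unset Strict Implicit. Unset Printing Implicit Defensive.
Import Order.TTheory GRing.Theory Num.Theory.

Definition simple_graph (T : finType) (e : rel T) : Prop :=
  symmetric e /\ irreflexive e.

Definition edges (T : finType) (e : rel T) : {set {set T}} :=
  [set E : {set T} | [exists x, exists y, e x y && (E == [set x; y])]].

Definition is_subgraph (T : finType) (e : rel T) (S : {set T}) (F : {set {set T}}) : Prop :=
  F \subset edges e /\ forall E, E \in F -> E \subset S.

Definition is_bipartite (T : finType) (S : {set T}) (F : {set {set T}}) : Prop :=
  exists A B : {set T}, [/\ A :|: B = S, [disjoint A & B] &
    forall E, E \in F -> exists x y, [/\ x \in A, y \in B & E = [set x; y]]].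

Definition in_class (R : realType) (m1 m2 : R) (T : finType) (e : rel T) : Prop :=
  (forall S F, is_subgraph e S F -> (#|F|%:R <= m1 * #|S|%:R :> R)%R) /\
  (forall S F, is_subgraph e S F -> is_bipartite S F ->
                (#|F|%:R <= m2 * #|S|%:R :> R)%R).

Definition degree (T : finType) (e : rel T) (v : T) : nat := #|[set u | e v u]|.

(* Maximum degree (0 for the empty graph). *)
Definition max_degree (T : finType) (e : rel T) : nat := \max_(v : T) degree e v.

(* Equitable r-coloring: a partition of the vertex set into r
   (possibly empty) independent colour classes V_i = f^-1(i) whose sizes
   pairwise differ by at most one. *)
Definition equitable_coloring (T : finType) (e : rel T) (r : nat) : Prop :=
  exists f : T -> 'I_r,
    (forall x y, e x y -> f x != f y) /\
    (forall i j : 'I_r, #|[set x | f x == i]| <= #|[set x | f x == j]|.+1).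

(* Main.v *)
Require Import Defs.
From HB Require Import structures.
From mathcomp Require Import all_boot all_order all_algebra.
From mathcomp Require Import reals.
From mathcomp Require Import boolp zify ring lra.
Import Order.TTheory GRing.Theory Num.Theory.
Local Open Scope ring_scope.
Set Implicit Arguments. Unset Strict Implicit. Unset Printing Implicit Defensive.

(** Suppose first that [r] divides the order, so that all classes must have the
    same size [s]. Vertices are activated one at a time: [x] has degree at most
    [2 m1] into the active part, and [f] is a balanced coloring that is proper
    apart from the edges at [x], so that [x] is a dummy in its class. A class [i]
    has an arc to [j] if some vertex other than [x] of class [i] has no neighbour
    in class [j]. If [x] has no neighbour in some class that reaches the class of
    [x] ("accessible"), then shifting one vertex along each arc of a path makes
    room for [x] there.

    Otherwise take [f] with the largest number of accessible classes. If no arc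
    enters a family of [k] classes, then it spans at least [k (r - k) s] edges of
    a bipartite graph, so [k (r - k) < m2 r]; by the equation defining [beta]
    this forces [k] or [r - k] to be "small", i.e. less than
    [beta r / (2 (1 + beta))]. Hence there are few accessible classes, and all
    but a small number of classes form a core [K] from which every class outside
    a small family [low] can be reached. A terminal accessible class [W] contains
    a vertex [w] with a neighbour in every other accessible class and with at
    least [#|K|] solo neighbours [y] outside [low] (those with [w] as only
    neighbour in [W]). If [w] can replace the solo neighbour [y1] among the
    inaccessible classes, then [y1] is adjacent to all other solo neighbours, as
    otherwise the exchange would create a new accessible class. There are so many
    such [y1] that the density bound [m1] is violated.

    If [r] does not divide the order, say the order is [r s - p] with
    [0 < p < r], then either [p + 1 <= 2 m1] and adding a disjoint clique on [p]
    vertices stays in the class, or a vertex of degree at most [2 m1] can be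
    removed and put back into one of the [p + 1] smaller classes. *)

(** * Arithmetic of [beta]: small numbers of classes *)

Definition small (R : realFieldType) (beta : R) (r k : nat) : bool :=
  2 * (1 + beta) * k%:R < beta * r%:R.

Section SmallNumbers.

Variables (R : realFieldType) (m1 m2 beta : R) (r : nat).
Hypotheses (hb1 : 1 / 2%:R <= beta) (hb2 : beta < 1).
Hypothesis hroot :
  2%:R * m2 * (1 - beta) * (1 + beta) ^+ 2 - m1 * beta * (2%:R + beta) = 0.
Hypothesis hr : 2 * m1 <= (1 - beta) * r%:R.

Lemma small_leq j k : (j <= k)%N -> small beta r k -> small beta r j.
Proof.
have b1 := hb1.
rewrite /small -(ler_nat R) => jk; apply: le_lt_trans.
by apply: ler_wpM2l => //; lra.
Qed.

(** Since [beta < 1], the ratio [beta / (2 (1 + beta))] is below [1/4]. *)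
Lemma small_lt4 k : small beta r k -> (4 * k < r)%N.
Proof.
have b1 := hb1; have b2 := hb2.
rewrite /small -(ltr_nat R) natrM => sk.
have k0 : 0 <= k%:R :> R by exact: ler0n.
nra.
Qed.

Lemma m2_bound : 4 * (1 + beta) ^+ 2 * m2 <= beta * (2 + beta) * r%:R.
Proof.
have b1 := hb1; have b2 := hb2; have r2 := hr.
have b0 : 0 < 1 - beta by lra.
rewrite -(ler_pM2l b0).
have -> : (1 - beta) * (4 * (1 + beta) ^+ 2 * m2) = 2 * m1 * (beta * (2 + beta)).
  move: hroot => /eqP; rewrite subr_eq0 => /eqP h.
  transitivity (2 * (2 * m2 * (1 - beta) * (1 + beta) ^+ 2)); first by ring.
  by rewrite h; ring.
have h : 0 <= beta * (2 + beta) by apply: mulr_ge0; lra.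
by have := ler_wpM2r h hr; lra.
Qed.

(** Put [c = beta / (2 (1 + beta))]. Then [c (1 - c) = beta (2 + beta) / (4 (1 + beta)^2)], so
    [m2_bound] reads [m2 <= c (1 - c) r], and [k / r] cannot lie in [[c, 1 - c]]. *)
Lemma small_dichotomy k : (k <= r)%N -> (k * (r - k))%:R < m2 * r%:R ->
  small beta r k || small beta r (r - k).
Proof.
have b1 := hb1; have b2 := hb2.
move=> kr; rewrite /small natrM natrB // => h.
have b0 : 0 < 4 * (1 + beta) ^+ 2 by apply: mulr_gt0; [lra|apply: exprn_gt0; lra].
have r0 : 0 <= r%:R :> R by exact: ler0n.
have h1 := ler_wpM2r r0 m2_bound.
have h2 : 4 * (1 + beta) ^+ 2 * (k%:R * (r%:R - k%:R)) <
  beta * (2 + beta) * r%:R * r%:R :> R.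
  by apply: lt_le_trans h1; rewrite -[ltRHS]mulrA ltr_pM2l.
case: ltP => //= h3; case: ltP => //= h4.
suff : 0 <= (2 * (1 + beta) * k%:R - beta * r%:R) *
  (2 * (1 + beta) * (r%:R - k%:R) - beta * r%:R) :> R.
  by move: h2; rewrite expr2; lra.
by apply: mulr_ge0; rewrite subr_ge0.
Qed.

Lemma double_le_of_le_2m1 a : a%:R <= 2 * m1 -> (2 * a <= r)%N.
Proof.
have b1 := hb1; have r2 := hr.
move=> h; rewrite -(ler_nat R) natrM.
have r0 : 0 <= r%:R :> R by exact: ler0n.
nra.
Qed.

(** The final numerical clash: [sg] counts solo neighbours, [m] those joined to all the others, [t]
    the classes outside the core. The left side does not decrease in [m] up to [sg], so [m] can be
    lowered to [r - 3 t]. *)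
Lemma joined_density_contradiction (t m sg : nat) :
  (0 < t)%N -> small beta r t -> (r <= sg + t)%N -> (r <= m + 3 * t)%N ->
  (m <= sg)%N ->
  ((m + 1) * (2 * sg - m))%:R <= 2 * m1 * (sg + 1)%:R -> False.
Proof.
have b1 := hb1; have b2 := hb2; have r2 := hr.
move=> t0 st sgt mt msg h.
have t4 := small_lt4 st.
have e1 : ((r - 3 * t + 1) * (2 * sg - (r - 3 * t)) <= (m + 1) * (2 * sg - m))%N.
  have [k mE] : exists k, m = (r - 3 * t + k)%N by exists (m - (r - 3 * t))%N; lia.
  case: k mE => [|k] mE; first by rewrite mE addn0.
  set u := (r - 3 * t)%N in mE *.
  have [j sE] : exists j, sg = (u + k.+1 + j)%N by exists (sg - m)%N; lia.
  have -> : (2 * sg - u = u + 2 * k.+1 + 2 * j)%N by lia.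
  have -> : (2 * sg - m = u + k.+1 + 2 * j)%N by lia.
  rewrite mE; nia.
have e2 : ((r - 3 * t + 1) * (2 * sg - (r - 3 * t)))%:R <= 2 * m1 * (sg + 1)%:R :> R.
  by apply: le_trans h; rewrite ler_nat.
have t4' : 4 * t%:R < r%:R :> R by rewrite -natrM ltr_nat.
have t0' : 1 <= t%:R :> R by rewrite ler1n.
have sgt' : r%:R <= sg%:R + t%:R :> R by rewrite -natrD ler_nat.
move: e2; rewrite natrM natrB; last lia.
rewrite (natrM _ 2 sg) !natrD.
have -> : (r - 3 * t)%:R = r%:R - 3 * t%:R :> R by rewrite natrB ?natrM //; lia.
move: st; rewrite /small.
move: t4' t0' sgt' hr; move: (r%:R) (t%:R) (sg%:R) => {h e1 mt msg t4 sgt t0}rr tt ss.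
move=> t4 t0 sgt hrr st h.
have h1 : (rr - 3 * tt + 1) * (2 * ss - (rr - 3 * tt)) <= (1 - beta) * rr * (ss + 1).
  by apply: le_trans h _; apply: ler_wpM2r => //; lra.
(* The difference of the two sides of [h1] has nonnegative slope in [ss], so [ss] may be lowered to
   [rr - tt]. *)
have h2 : 0 <= (2 * (rr - 3 * tt + 1) - (1 - beta) * rr) * (ss + tt - rr).
  apply: mulr_ge0; last lra.
  have : 0 <= (beta - 1 / 2) * rr by apply: mulr_ge0; lra.
  lra.
have h3 : (rr - 3 * tt + 1) * (rr + tt) <= (1 - beta) * rr * (rr - tt + 1) by lra.
have h4 : 0 < (beta * rr - 2 * (1 + beta) * tt) * (rr - tt + 1).
  by apply: mulr_gt0; lra.
have h5 : 0 <= (beta - 1 / 2) * (tt * (rr - tt + 1)).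
  by apply: mulr_ge0; [lra | apply: mulr_ge0; lra].
have h6 : 0 < tt * (rr - 3 * tt + 2) by apply: mulr_gt0; lra.
lra.
Qed.

End SmallNumbers.

Local Open Scope nat_scope.

(** * Edge counts and the density bounds *)

(** Ordered pairs are counted: in a simple graph an edge inside [S] adds two to [edge_count e S S],
    while an edge between disjoint [A] and [B] adds one to [edge_count e A B]. *)
Definition edge_count (T : finType) (e : rel T) (A B : {set T}) : nat :=
  \sum_(u in A) \sum_(v in B) e u v.

Lemma card_set_sum (T : finType) (P : pred T) : #|[set x | P x]| = \sum_x P x.
Proof. by rewrite cardsE -sum1_card big_mkcond. Qed.

Lemma edge_countE (T : finType) (e : rel T) (A B : {set T}) :
  edge_count e A B = #|[set p : T * T | [&& p.1 \in A, p.2 \in B & e p.1 p.2]]|.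
Proof.
rewrite card_set_sum /edge_count big_mkcond /=.
rewrite -(pair_big_dep predT (fun _ => predT)
  (fun u v => ([&& u \in A, v \in B & e u v] : nat))) /=.
apply: eq_bigr => u _; case: (u \in A) => /=; last by rewrite big1.
by rewrite big_mkcond; apply: eq_bigr => v _; case: (v \in B).
Qed.

Lemma set2_cases (T : finType) (u v a b : T) :
  [set u; v] = [set a; b] -> (u = a /\ v = b) \/ (u = b /\ v = a).
Proof.
move=> E.
have : u \in [set a; b] by rewrite -E !inE eqxx.
have : v \in [set a; b] by rewrite -E !inE eqxx orbT.
have : a \in [set u; v] by rewrite E !inE eqxx.
have : b \in [set u; v] by rewrite E !inE eqxx orbT.
rewrite !inE.
by do 4!(case/orP => /eqP ?); subst; auto.
Qed.

Section ClassDensity.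
Variables (R : realType) (m1 m2 : R) (T : finType) (e : rel T).
Hypotheses (hG : simple_graph e) (hclass : in_class m1 m2 e).

Lemma in_class_density (S : {set T}) :
  ((edge_count e S S)%:R <= 2 * m1 * #|S|%:R :> R)%R.
Proof.
case: hG => esym eirr; case: hclass => h1 _.
pose F := [set E in edges e | E \subset S].
have hF : is_subgraph e S F.
  by split; [apply/subsetP=> E; rewrite inE => /andP[] | move=> E; rewrite inE => /andP[]].
suff h : edge_count e S S <= 2 * #|F|.
  have := h1 _ _ hF; move: h; rewrite -(ler_nat R) natrM; lra.
rewrite edge_countE; set D := [set p | _].
pose h (p : T * T) := [set p.1; p.2].
have hD p : p \in D -> h p \in F.
  rewrite !inE => /and3P[p1 p2 ep]; rewrite subUset !sub1set p1 p2 !andbT.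
  by apply/existsP; exists p.1; apply/existsP; exists p.2; rewrite ep /=.
rewrite -sum1_card (partition_big h (mem F)) //= mulnC -sum_nat_const.
apply: leq_sum => E; rewrite /= /F /edges !inE => /andP[/existsP[a /existsP[b /andP[_ /eqP->]]] _].
rewrite sum1_card.
apply: (@leq_trans #|[set (a, b); (b, a)]|).
  apply/subset_leq_card/subsetP => -[u v]; rewrite !inE => /andP[_ /eqP /set2_cases] /=.
  by case=> -[-> ->]; rewrite eqxx ?orbT.
by rewrite cards2; case: (_ != _).
Qed.

Lemma in_class_bipartite_density (A B : {set T}) : [disjoint A & B] ->
  ((edge_count e A B)%:R <= m2 * (#|A| + #|B|)%:R :> R)%R.
Proof.
move=> dAB; case: hG => esym eirr; case: hclass => _ h2.
rewrite edge_countE; set D := [set p | _].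
pose h (p : T * T) := [set p.1; p.2].
have hE E : E \in h @: D -> exists u v, [/\ u \in A, v \in B, e u v & E = [set u; v]].
  by case/imsetP=> -[u v]; rewrite inE /= => /and3P[uA vB uv] ->; exists u, v.
have inj : {in D &, injective h}.
  move=> [u v] [a b]; rewrite !inE /= => /and3P[uA vB _] /and3P[aA bB _] /set2_cases /=.
  case=> -[ua va]; first by rewrite ua va.
  by move/pred0P: dAB => /(_ u) /=; rewrite uA ua bB.
rewrite -(card_in_imset inj).
have <- : #|A :|: B| = #|A| + #|B|.
  by rewrite cardsU disjoint_setI0 // cards0 subn0.
apply: h2.
- split; first apply/subsetP.
    move=> E /hE[u [v [uA vB uv ->]]]; rewrite /edges inE.
    by apply/existsP; exists u; apply/existsP; exists v; rewrite uv /=.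
  move=> E /hE[u [v [uA vB uv ->]]].
  by rewrite subUset !sub1set !inE uA vB orbT.
- by exists A, B; split=> // E /hE[u [v [uA vB uv ->]]]; exists u, v.
Qed.

End ClassDensity.

(** * Terminal vertices of a digraph *)

(** Choose [W != v0] such that as many vertices as possible reach [v0] avoiding [W]. If [W] cut off
    some [X], all these vertices, and [W] too, would reach [v0] avoiding [X], against maximality. *)
Lemma exists_terminal (I : finType) (D : rel I) (v0 : I) :
  exists W, [/\ connect D W v0,
    (forall X, connect D X v0 -> X != W ->
       connect [rel i j | [&& D i j, i != W & j != W]] X v0) &
    (W = v0 -> forall X, connect D X v0 -> X = v0)].
Proof.
pose av W := [rel i j | [&& D i j, i != W & j != W]].
pose rc W := [set X | (X != W) && connect (av W) X v0].
case: (pickP [pred W | (W != v0) && connect D W v0]) => [W0 hW0|none]; last first.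
  have only X : connect D X v0 -> X = v0.
    by move=> h; have := none X; rewrite /= h andbT => /negbFE/eqP.
  by exists v0; split=> // X /only->; rewrite eqxx.
case: (arg_maxnP (fun W => #|rc W|) hW0) => W /andP[Wv0 hW] Wmax.
exists W; split=> //; last by move=> E; rewrite E eqxx in Wv0.
move=> X hX XW; apply: contraT => nX.
have Xv0 : X != v0 by apply: contraNneq nX => ->.
have := Wmax X; rewrite /= Xv0 hX => /(_ isT).
suff : rc W \proper rc X by move/proper_card; lia.
have XnW : X \notin rc W by rewrite inE XW.
have rcv : v0 \in rc W by rewrite inE eq_sym Wv0 connect0.
have sub Y : Y \in rc W -> connect (av X) Y v0.
  rewrite inE => /andP[YW /connectP[p]].
  elim: p Y YW => [|Z p IH] Y YW /=; first by move=> _ ->.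
  case/andP => /and3P[YZ _ ZW] pp lp.
  have hZ : connect (av W) Z v0 by apply/connectP; exists p.
  have hY : connect (av W) Y v0.
    by apply: connect_trans hZ; apply: connect1; rewrite /= YZ YW ZW.
  apply: connect_trans (IH Z ZW pp lp); apply: connect1 => /=; rewrite YZ /=.
  by apply/andP; split; apply: contraNneq nX => <-.
(* After its first step a repetition-free path never returns to [W], so it continues inside
   [rc W]. *)
have subW : connect (av X) W v0.
  have [p pp lp] := connectP hW; case/shortenP: pp lp => q pq uq _ lq.
  case: q pq uq lq => [|Z q] /=; first by move=> _ _ E; rewrite E eqxx in Wv0.
  case/andP => WZ pq /andP[Wq uq] lq.
  have ZW : Z != W by apply: contraNneq Wq => ->; rewrite mem_head.
  have Zr : Z \in rc W.
    rewrite inE ZW; apply/connectP; exists q => //.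
    elim: q Z ZW {lq WZ} pq Wq uq => [//|Y q IH] Z ZW /= /andP[ZY pq].
    rewrite !inE !negb_or => /and3P[WZ WY Wq] /andP[_ uq].
    rewrite ZY ZW (eq_sym Y) WY /=; apply: IH => //; first by rewrite eq_sym.
    by rewrite inE negb_or WY.
  apply: connect_trans (sub _ Zr); apply: connect1 => /=; rewrite WZ eq_sym XW /=.
  by apply: contraNneq XnW => <-.
apply/properP; split.
  apply/subsetP => Y YrW; rewrite inE sub // andbT.
  by apply: contraNneq XnW => <-.
exists W; last by rewrite inE eqxx.
by rewrite inE subW eq_sym XW.
Qed.

(** * Recoloring and shifts along paths of arcs *)

Section Recoloring.
Variables (T : finType) (r : nat) (e : rel T) (x : T).
Implicit Types f g : T -> 'I_r.

Definition proper_col f := forall u v, e u v -> f u != f v.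
Definition cls f (i : 'I_r) : {set T} := [set v | f v == i].
Definition recolor f v c := fun u => if u == v then c else f u.
Definition nonadj f v (j : 'I_r) := [forall u, e v u ==> (f u != j)].
Definition move_arc f : rel 'I_r :=
  fun i j => [exists v, [&& f v == i, v != x & nonadj f v j]].

Hypotheses (esym : symmetric e) (eirr : irreflexive e).

Lemma nonadjP f v j : reflect (forall u, e v u -> f u <> j) (nonadj f v j).
Proof.
apply: (iffP forallP) => h u; first by move=> ev; apply/eqP; move: ev; apply/implyP.
by apply/implyP => /h hu; apply/eqP.
Qed.

Lemma not_nonadjP f v j : ~~ nonadj f v j -> exists2 u, e v u & f u = j.
Proof.
by rewrite negb_forall => /existsP[u]; rewrite negb_imply negbK => /andP[? /eqP]; exists u.
Qed.

Lemma recolor_proper f v c : proper_col f -> nonadj f v c -> proper_col (recolor f v c).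
Proof.
move=> pf /nonadjP fv u w uw; rewrite /recolor.
case: (u =P v) => [uE|_]; case: (w =P v) => [wE|_]; last exact: pf.
- by rewrite uE wE eirr in uw.
- by rewrite eq_sym; apply/eqP; apply: fv; rewrite -uE.
- by apply/eqP; apply: fv; rewrite -wE esym.
Qed.

Lemma card_cls_recolor f v c d :
  #|cls (recolor f v c) d| + (d == f v) = #|cls f d| + (d == c).
Proof.
rewrite /cls !card_set_sum (bigD1 v) //= (bigD1 (F := fun u => f u == d : nat) v) //=.
rewrite {1}/recolor eqxx [c == d]eq_sym [f v == d]eq_sym.
rewrite (eq_bigr (fun u => (f u == d : nat))); first by lia.
by move=> u /negbTE uv; rewrite /recolor uv.
Qed.

Lemma sum_card_cls f : \sum_i #|cls f i| = #|T|.
Proof.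
rewrite -sum1_card (partition_big f predT) //=.
by apply: eq_bigr => i _; rewrite sum1_card cardsE.
Qed.

(** One vertex moves along each arc, so class [i] loses a vertex and the last class gains one. The
    tail of the path is shifted first; since its first class [j] receives no vertex in that shift,
    [v] can still enter [j] afterwards. *)
Lemma shift_path f i p : proper_col f -> path (move_arc f) i p -> uniq (i :: p) ->
  exists g, [/\ proper_col g, g x = f x,
    (forall v, f v \notin i :: p -> g v = f v) /\
    (forall v, f v \in i :: p -> g v \in i :: p),
    (forall v, g v = i -> f v = i) /\
    (forall v, f v = last i p -> g v = last i p) &
    forall c, #|cls g c| + (c == i) = #|cls f c| + (c == last i p)].
Proof.
move=> pf; elim: p i => [|j p IH] i; first by move=> _ _; exists f.
move=> /= /andP[/existsP[v /and3P[/eqP fv vx fr]] pp] /andP[ijp ujp].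
have [g [pg gx [gout gin] [gst gend] gc]] := IH j pp ujp.
have gv : g v = i by rewrite gout fv.
have ij : i != j by apply: contraNneq ijp => ->; rewrite mem_head.
exists (recolor g v j); split.
- apply: recolor_proper => //; apply/nonadjP => u vu /gst.
  exact: (elimT (nonadjP f v j) fr).
- by rewrite /recolor eq_sym (negbTE vx).
- split=> u; rewrite /recolor inE.
    rewrite negb_or => /andP[ui uj]; case: (u =P v) => [uE|_]; last exact: gout.
    by rewrite uE fv eqxx in ui.
  case: (u =P v) => [_ _|_]; first by rewrite !inE eqxx orbT.
  case/orP => [/eqP fu|fu]; last by rewrite inE gin ?orbT.
  by rewrite gout fu ?mem_head.
- split=> u; rewrite /recolor; case: (u =P v) => [->|_] //.
  + move=> gu; case fjp: (f u \in j :: p); last by rewrite -gu gout // fjp.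
    by have := gin _ fjp; rewrite gu (negbTE ijp).
  + by rewrite fv => E; rewrite E mem_last in ijp.
  + exact: gend.
- move=> c; have := card_cls_recolor g v j c; rewrite gv.
  by have := gc c; move: #|cls _ c| #|cls _ c| #|cls _ c|; clear; lia.
Qed.

(** Keeping the path inside [A] fixes all vertices outside [A]: shifts among accessible classes
    leave the others alone, and conversely. *)
Lemma shift_connect (A : pred 'I_r) f i k : proper_col f ->
  connect [rel a b | [&& move_arc f a b, A a & A b]] i k -> A i ->
  exists g, [/\ proper_col g, g x = f x,
    (forall v, ~~ A (f v) -> g v = f v) /\ (forall v, A (f v) -> A (g v)),
    (forall v, g v = i -> f v = i) /\ (forall v, f v = k -> g v = k) &
    forall c, #|cls g c| + (c == i) = #|cls f c| + (c == k)].
Proof.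
move=> pf /connectP[p0 pp0 lp0] Ai.
case/shortenP: pp0 lp0 => p pp up _ kE.
have pA : all A (i :: p).
  rewrite /= Ai /=; elim: p i {up kE} Ai pp => //= j p IH i Ai /andP[/and3P[_ _ Aj] pp].
  by rewrite Aj (IH j).
have pp' : path (move_arc f) i p by apply: sub_path pp => a b /and3P[].
have [g [pg gx [gout gin] gse gc]] := shift_path pf pp' up.
exists g; rewrite kE; split=> //; split=> v Av.
  by apply: gout; apply: contra Av => /(allP pA).
case fvp: (f v \in i :: p); last by rewrite gout ?fvp.
exact: (allP pA _ (gin _ fvp)).
Qed.

End Recoloring.

Definition acc (T : finType) (r : nat) (e : rel T) (x : T) (f : T -> 'I_r) : {set 'I_r} :=
  [set i | connect (move_arc e x f) i (f x)].

(** * Cuts between families of classes *)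

Section MaximalAccessible.
Variables (R : realFieldType) (m1 m2 beta : R).
Variables (T : finType) (r s : nat) (e : rel T) (x : T).
Hypothesis hm2 : (0 < m2)%R.
Hypotheses (hb1 : (1 / 2%:R <= beta)%R) (hb2 : (beta < 1)%R).
Hypothesis hroot :
  (2%:R * m2 * (1 - beta) * (1 + beta) ^+ 2 - m1 * beta * (2%:R + beta) = 0)%R.
Hypothesis hr : (2 * m1 <= (1 - beta) * r%:R)%R.
Hypotheses (esym : symmetric e) (eirr : irreflexive e).
Hypothesis ex0 : forall u, e x u = false.
Hypothesis hdeg : forall v, #|[set u | e v u]| <= r.
Hypothesis hdens :
  forall S, ((edge_count e S S)%:R <= 2 * m1 * #|S|%:R :> R)%R.
Hypothesis hbip : forall A B : {set T}, [disjoint A & B] ->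
  ((edge_count e A B)%:R <= m2 * (#|A| + #|B|)%:R :> R)%R.

Variable f : T -> 'I_r.
Hypotheses (pf : proper_col e f) (bf : forall i, #|cls f i| = s).

Local Notation A := (acc e x f).
Local Notation arc := (move_arc e x f).
Local Notation small := (small beta r).

Lemma fx_acc : f x \in A.
Proof. by rewrite inE connect0. Qed.

Lemma ex0r u : e u x = false.
Proof. by rewrite esym. Qed.

Definition arc_closed (C : {set 'I_r}) :=
  forall i j, i \notin C -> j \in C -> ~~ arc i j.

Lemma not_arc_nbr i j v : ~~ arc i j -> f v = i -> v != x -> exists2 u, e v u & f u = j.
Proof.
rewrite negb_exists => /forallP /(_ v) na fv vx; apply: not_nonadjP.
by move: na; rewrite fv eqxx vx.
Qed.

Definition cls_edges i j := edge_count e (cls f i) (cls f j).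

Lemma cls_edgesC i j : cls_edges i j = cls_edges j i.
Proof.
rewrite /cls_edges /edge_count exchange_big /=.
by apply: eq_bigr => u _; apply: eq_bigr => v _; rewrite esym.
Qed.

Lemma not_arc_edges i j : ~~ arc i j -> f x != i -> s <= cls_edges i j.
Proof.
move=> na xi; rewrite -(bf i) -sum1_card; apply: leq_sum => v; rewrite inE => /eqP fv.
have [|u vu fu] := not_arc_nbr na fv; first by apply: contraNneq xi => <-; apply/eqP.
by rewrite (bigD1 u) ?inE ?fu //= vu.
Qed.

Lemma card_classes : #|T| = r * s.
Proof.
rewrite -(sum_card_cls f) -[X in X * s]card_ord -sum_nat_const.
by apply: eq_bigr => i _; rewrite bf.
Qed.

(** The pairs of classes across [C] yield [|C| (r - |C|) s] edges of a bipartite graph. The isolated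
    vertex [x] is left out, so this graph has [r s - 1] vertices, which makes the inequality for
    [small_dichotomy] strict. Edges rather than arcs are assumed because the core has arcs missing
    in either direction. *)
Lemma cut_dichotomy (C : {set 'I_r}) : f x \in C ->
  (forall i j, i \notin C -> j \in C -> s <= cls_edges i j) ->
  small #|C| || small (r - #|C|).
Proof.
move=> xC hC.
have kr : #|C| <= r by rewrite -[X in _ <= X]card_ord max_card.
apply: (small_dichotomy hb1 hb2 hroot hr) => //.
pose A0 := [set v | f v \notin C]; pose B0 := [set v | (f v \in C) && (v != x)].
have dAB : [disjoint A0 & B0].
  by apply/pred0P => v /=; rewrite !inE; case: (f v \in C).
have cAB : (#|A0| + #|B0|).+1 = r * s.
  have -> : #|A0| + #|B0| = #|[set~ x]|.
    rewrite -[RHS]/#|pred_of_set _| -[LHS]subn0 -(@cards0 T).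
    rewrite -(disjoint_setI0 dAB) -cardsU; congr #|pred_of_set _|.
    apply/setP => v; rewrite !inE; case: eqP => [->|_]; first by rewrite xC.
    by case: (f v \in C).
  by rewrite cardsC1 -card_classes prednK //; apply/card_gt0P; exists x.
have cnt : (#|C| * (r - #|C|)) * s <= edge_count e A0 B0.
  have -> : edge_count e A0 B0 = \sum_(i in ~: C) \sum_(j in C) cls_edges i j.
    rewrite /edge_count (partition_big f (mem (~: C))) /=; last by move=> v; rewrite !inE.
    apply: eq_bigr => i; rewrite inE => iC; rewrite /cls_edges /edge_count [RHS]exchange_big /=.
    apply: eq_big => [v|v _].
      by rewrite !inE; case: (f v =P i) => [->|]; rewrite ?andbF // iC.
    rewrite (partition_big f (mem C)) /=; last by move=> u; rewrite inE => /andP[].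
    apply: eq_bigr => j jC; rewrite big_mkcond [RHS]big_mkcond /=.
    apply: eq_bigr => u _; rewrite !inE; case: (f u =P j) => [->|]; last by rewrite andbF.
    by rewrite jC andbT /=; case: eqP => [->|//]; rewrite ex0r.
  have -> : r - #|C| = #|~: C|.
    by have := cardsC C; rewrite card_ord; lia.
  have -> : #|C| * #|~: C| * s = \sum_(i in ~: C) \sum_(j in C) s.
    by rewrite !sum_nat_const; lia.
  apply: leq_sum => i iC; apply: leq_sum => j jC; apply: hC => //.
  by rewrite inE in iC.
have s0 : 0 < s by move: cAB; case: s => // /eqP; rewrite muln0.
have s0' : (0 < s%:R :> R)%R by rewrite ltr0n.
rewrite -(ltr_pM2r s0') -natrM.
apply: (@le_lt_trans _ _ (edge_count e A0 B0)%:R)%R; first by rewrite ler_nat.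
apply: le_lt_trans (hbip dAB) _; rewrite -mulrA ltr_pM2l // -natrM ltr_nat -cAB.
exact: ltnSn.
Qed.

Lemma closed_dichotomy (C : {set 'I_r}) : f x \in C -> arc_closed C -> small #|C| || small (r - #|C|).
Proof.
move=> xC cC; apply: cut_dichotomy => // i j iC jC.
by apply: not_arc_edges; [exact: cC | apply: contraNneq iC => <-].
Qed.

Lemma acc_closed : arc_closed A.
Proof.
move=> i j iA; rewrite inE => jx; apply: contra iA => ij; rewrite inE.
exact: connect_trans (connect1 ij) jx.
Qed.

(** Including [A] puts the class of [x] into the family, as [closed_dichotomy] requires. *)
Definition above i : {set 'I_r} := A :|: [set j | connect arc j i].

Lemma above_closed i : arc_closed (above i).
Proof.
move=> j k; rewrite !inE negb_or => /andP[jx ji]; apply: contraTN => jk.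
rewrite negb_or; apply/andP; split; [apply: contra jx|apply: contra ji];
  exact: connect_trans (connect1 jk).
Qed.

Lemma fx_above i : f x \in above i.
Proof. by rewrite inE fx_acc. Qed.

Lemma mem_above i : i \in above i.
Proof. by rewrite !inE connect0 orbT. Qed.

Lemma sub_above i j : connect arc i j -> above i \subset above j.
Proof.
move=> ij; apply: setUS; apply/subsetP => k; rewrite !inE => ki.
exact: connect_trans ki ij.
Qed.

Lemma above_acc i : i \in A -> above i = A.
Proof.
rewrite inE => ix; apply/setUidPl/subsetP => j; rewrite !inE => ji.
exact: connect_trans ji ix.
Qed.

(** * Low classes and the core *)

Definition low : {set 'I_r} := [set i | small #|above i|].

Hypothesis acc_half : 2 * #|A| <= r.

Lemma small_lt4r k : small k -> 4 * k < r.
Proof. exact: small_lt4. Qed.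

Lemma small_acc : small #|A|.
Proof.
have /orP[//|/small_lt4r] := closed_dichotomy fx_acc acc_closed.
by have := acc_half; lia.
Qed.

Lemma acc_low : A \subset low.
Proof. by apply/subsetP => i iA; rewrite inE above_acc // small_acc. Qed.

Lemma above_low i : i \in low -> above i \subset low.
Proof.
rewrite inE => si; apply/subsetP => j; rewrite 3!inE => /orP[jA|ji].
  by move/subsetP: acc_low; apply; rewrite inE.
by rewrite inE in ji *; apply: small_leq si => //; apply/subset_leq_card/sub_above.
Qed.

Lemma low_closed : arc_closed low.
Proof.
move=> i j il jl; apply: contra il => ij; apply: (subsetP (above_low jl)).
by rewrite !inE (connect1 ij) orbT.
Qed.

(* A union of small arc-closed families stays below [r / 2], hence is again
   small by the dichotomy. *)
Lemma small_low : small #|low|.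
Proof.
have [C [-> xC cC sC]] : exists C, [/\ low = C, f x \in C, arc_closed C & small #|C|].
  suff [C [lC xC cC sC Cl]] : exists C : {set 'I_r}, [/\ {subset enum low <= C}, f x \in C,
     arc_closed C, small #|C| & C \subset low].
    exists C; split=> //; apply/eqP; rewrite eqEsubset Cl andbT.
    by apply/subsetP => i il; apply: lC; rewrite mem_enum.
  have : {subset enum low <= low} by move=> i; rewrite mem_enum.
  elim: (enum low) => [_|i l IH ll].
    by exists A; split=> //; [exact: fx_acc|exact: acc_closed|exact: small_acc|exact: acc_low].
  have [|C [lC xC cC sC Cl]] := IH; first by move=> j jl; apply: ll; rewrite inE jl orbT.
  have il : i \in low by apply: ll; rewrite mem_head.
  have cD : arc_closed (above i :|: C).
    move=> j k; rewrite in_setU negb_or => /andP[ja jC]; rewrite in_setU => /orP[].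
      exact: above_closed.
    exact: cC.
  exists (above i :|: C); split=> //.
  - move=> j; rewrite inE => /orP[/eqP->|/lC jC]; rewrite in_setU ?mem_above //.
    by rewrite jC orbT.
  - by rewrite in_setU xC orbT.
  - have xD : f x \in above i :|: C by rewrite in_setU xC orbT.
    have /orP[//|/small_lt4r] := closed_dichotomy xD cD.
    have /small_lt4r : small #|above i| by rewrite inE in il.
    move: (small_lt4r sC) (leq_card_setU (above i) C).1.
    by move: #|C| #|above i| #|_| => a b c; clear; lia.
  - by rewrite subUset above_low.
exact: sC.
Qed.

(** Take [i0] outside [low] with [above i0] smallest, and [K] as [above i0] minus [low]. For [i]
    outside [low], both [above i] and [above i0] miss fewer than [r / 4] classes, so they share some
    [k] outside [low]. By minimality [above k] equals [above i0], so each class of [K] reaches [k]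
    and then [i]. *)
Lemma exists_core : exists K : {set 'I_r}, [/\ [disjoint K & low], small (r - #|K|) &
  forall i j, j \in K -> i \notin low -> connect arc j i].
Proof.
have lr := small_lt4r small_low.
have cosmall i : i \notin low -> small (r - #|above i|).
  by rewrite inE => ni; have := closed_dichotomy (fx_above i) (@above_closed i); rewrite (negbTE ni).
have cardr (C : {set 'I_r}) : #|C| <= r by rewrite -[X in _ <= X]card_ord max_card.
have [i1 i1l] : exists i, i \notin low.
  have : 0 < #|~: low| by have := cardsC low; rewrite card_ord; lia.
  by case/card_gt0P => i; rewrite inE; exists i.
case: (@arg_minnP _ i1 [pred i | i \notin low] (fun i => #|above i|) i1l) => i0 /= i0l i0min.
pose K := above i0 :\: low.
have reach i j : j \in K -> i \notin low -> connect arc j i.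
  rewrite in_setD => /andP[jl ji0] il.
  have [k] : exists k, (k \in above i :&: above i0) && (k \notin low).
    apply/existsP; apply: contraT; rewrite negb_exists => /forallP no.
    have sub : above i :&: above i0 \subset low.
      by apply/subsetP => k kI; have := no k; rewrite kI /= negbK.
    move: (subset_leq_card sub) (cardsUI (above i) (above i0)) lr.
    move: (cardr (above i :|: above i0)) (small_lt4r (cosmall _ il)) (small_lt4r (cosmall _ i0l)).
    by move: #|low| #|above i| #|above i0| #|_ :|: _| #|_| => a b c d k; clear; lia.
  rewrite in_setI => /andP[/andP[ki ki0] kl].
  have kA : k \notin A by apply: contra kl => /(subsetP acc_low).
  have jA : j \notin A by apply: contra jl => /(subsetP acc_low).
  move: ki ki0; rewrite !in_setU (negbTE kA) /= !inE => ki ki0.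
  have E : above k = above i0.
    by apply/eqP; rewrite eqEcard sub_above // i0min.
  have := subsetP (sub_above ki) j; rewrite E ji0 => /(_ isT).
  by rewrite in_setU (negbTE jA) inE.
exists K; split=> //; first by rewrite -setI_eq0 /K setDE -setIA [~: low :&: _]setIC setICr setI0.
have Cle : #|~: K| <= #|low| + (r - #|above i0|).
  have -> : ~: K = low :|: ~: above i0 by rewrite /K setDE setCI setCK setUC.
  have := (leq_card_setU low (~: above i0)).1.
  by have := cardsC (above i0); rewrite card_ord; lia.
have KE : r - #|K| = #|~: K| by have := cardsC K; rewrite card_ord; lia.
rewrite KE.
have xK : f x \in ~: K.
  by rewrite in_setC in_setD negb_and negbK (subsetP acc_low _ fx_acc).
have /orP[//|] : small #|~: K| || small (r - #|~: K|).
  (* No arc goes from [K] into [low], and none from outside [above i0] into [K]; either way the pair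
     carries [s] edges. *)
  apply: cut_dichotomy => // i j; rewrite in_setC negbK in_setD => /andP[il ia].
  rewrite in_setC in_setD negb_and negbK => jC.
  case jl : (j \in low).
    apply: not_arc_edges; first exact: low_closed.
    by apply: contraNneq il => <-; apply: (subsetP acc_low); exact: fx_acc.
  rewrite jl /= in jC; rewrite cls_edgesC; apply: not_arc_edges.
    exact: above_closed jC ia.
  by apply: contraNneq jC => <-; exact: fx_above.
move/small_lt4r: (cosmall _ i0l) lr Cle => + + + /small_lt4r.
by move: #|low| #|above i0| #|~: K|; clear; lia.
Qed.

Hypothesis acc_max : forall g : T -> 'I_r, proper_col e g -> (forall i, #|cls g i| = s) ->
  #|acc e x g| <= #|A|.

(** * Exchanges at a terminal accessible class *)

Section Terminal.
Variable W : 'I_r.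
Hypothesis WA : W \in A.
Hypothesis Wterm : forall X, X \in A -> X != W ->
  connect [rel i j | [&& arc i j, i != W & j != W]] X (f x).
Hypothesis Wroot : W = f x -> forall X, X \in A -> X = f x.

Definition movable w := [exists X, [&& X \in A, X != W & nonadj e f w X]].
Definition solo w y := [forall u, (f u == W) && e y u ==> (u == w)].

Lemma soloP w y : reflect (forall u, f u = W -> e y u -> u = w) (solo w y).
Proof.
apply: (iffP forallP) => h u; last by apply/implyP => /andP[/eqP fu eu]; apply/eqP/h.
by move=> /eqP fu eu; apply/eqP; apply: (implyP (h u)); rewrite fu.
Qed.

Lemma connect_terminal X : X \in A -> X != W ->
  connect [rel i j | [&& arc i j, [pred k | (k \in A) && (k != W)] i &
                          [pred k | (k \in A) && (k != W)] j]] X (f x).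
Proof.
move=> XA XW; have [p pp lp] := connectP (Wterm XA XW).
elim: p X XA XW pp lp => [|Y p IH] X XA XW /=; first by move=> _ ->.
case/andP => /and3P[XY _ YW] pp lp.
have YA : Y \in A.
  rewrite inE lp; apply/connectP; exists p => //.
  by apply: sub_path pp => i j /and3P[].
apply: connect_trans (IH Y YA YW pp lp); apply: connect1.
by rewrite /= XY XA XW YA YW.
Qed.

Lemma connect_notin_acc i j : i \notin A -> connect arc i j ->
  connect [rel a b | [&& arc a b, a \notin A & b \notin A]] i j.
Proof.
move=> iA /connectP[p pp ->]; elim: p i iA pp => [|k p IH] i iA //=.
case/andP => ik pp.
have kA : k \notin A by apply: contraL ik; exact: acc_closed.
by apply: connect_trans (IH k kA pp); apply: connect1; rewrite /= ik iA kA.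
Qed.

(* Moving [w] into the accessible classes frees the place of [y] in [W], and
   the class of [y] becomes the one that contains the dummy vertex [x]. *)
Lemma movable_solo w y : f w = W -> movable w -> f y \notin A -> solo w y ->
  #|above (f y) :\: A| <= #|A|.
Proof.
move=> fw /existsP[X /and3P[XA XW /nonadjP fX]] yA /soloP sy.
have Wx : W != f x by apply: contraNneq XW => E; rewrite (Wroot E XA) -E.
have wx : w != x by apply: contraNneq Wx => <-; rewrite fw.
have wy : w != y by apply: contraNneq yA => <-; rewrite fw.
have xy : x != y by apply: contraNneq yA => <-; rewrite fx_acc.
have [|g [pg gx [gout gin] [gst gend] gc]] := shift_connect esym eirr pf (connect_terminal XA XW).
  by rewrite /= XA XW.
have gW u : g u = W -> f u = W.
  case hu : ((f u \in A) && (f u != W)).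
    by move=> gu; have := gin u hu; rewrite /= gu eqxx andbF.
  by rewrite gout //= hu.
have gnA u : g u \notin A -> f u = g u.
  case hu : ((f u \in A) && (f u != W)); last by rewrite gout //= hu.
  by have := gin u hu => /= /andP[->].
have gB u : f u \notin A -> g u = f u by move=> uA; rewrite gout //= (negbTE uA).
have gw : g w = W by rewrite gout //= fw eqxx andbF.
have gy : g y = f y by rewrite gB.
(* Under [g], class [X] has lost a vertex and the class of [x] has gained one. Moving [w] to [X],
   [y] to [W] and [x] to the class of [y] restores all sizes. *)
pose g1 := recolor g w X; pose g2 := recolor g1 y W; pose g3 := recolor g2 x (f y).
have p1 : proper_col e g1.
  by apply: recolor_proper => //; apply/nonadjP => u wu /gst; apply: fX.
have p2 : proper_col e g2.
  apply: recolor_proper => //; apply/nonadjP => u yu; rewrite /g1 /recolor.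
  case: (u =P w) => [_ E|uw gu]; first by rewrite E eqxx in XW.
  by apply: uw; apply: sy => //; apply: gW.
have p3 : proper_col e g3.
  by apply: recolor_proper => //; apply/nonadjP => u; rewrite ex0.
have b3 i : #|cls g3 i| = s.
  have := card_cls_recolor g2 x (f y) i; have := card_cls_recolor g1 y W i.
  have := card_cls_recolor g w X i; have := gc i; have := bf i.
  have -> : g2 x = f x.
    by rewrite /g2 /g1 /recolor (negbTE xy) eq_sym (negbTE wx).
  have -> : g1 y = f y by rewrite /g1 /recolor eq_sym (negbTE wy).
  rewrite -/g1 -/g2 -/g3 gw.
  move: #|cls f i| #|cls g i| #|cls g1 i| #|cls g2 i| #|cls g3 i| => c0 c1 c2 c3 c4.
  by move: (i == X : nat) (i == W : nat) (i == f y : nat) (i == f x : nat); clear; lia.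
apply: leq_trans (acc_max p3 b3); apply/subset_leq_card/subsetP => i.
rewrite in_setD in_setU => /andP[iA]; rewrite (negbTE iA) /= !inE.
have -> : g3 x = f y by rewrite /g3 /recolor eqxx.
case/connectP => p; elim: p i iA => [|j p IH] i iA /=; first by move=> _ ->; rewrite connect0.
case/andP => ij pp lp; case: (i =P f y) => [->|iy]; first exact: connect0.
have jA : j \notin A by apply: contraL ij; exact: acc_closed.
apply: connect_trans (IH j jA pp lp); apply: connect1.
(* The witness [v] of the arc still works: it keeps its color, and the only vertex entering an
   inaccessible class is [x], which has no neighbours. *)
case/existsP: ij => v /and3P[/eqP fv vx /nonadjP fj].
have vw : v != w by apply: contraNneq iA => E; rewrite -fv E fw.
have vy : v != y by apply/eqP => E; apply: iy; rewrite -fv E.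
apply/existsP; exists v; rewrite vx /g3 /g2 /g1 /recolor (negbTE vx) (negbTE vw) (negbTE vy).
rewrite gB ?fv // eqxx /=; apply/nonadjP => u vu.
case: (u =P x) => [E|_]; first by rewrite E ex0r in vu.
case: (u =P y) => [_ E|_]; first by rewrite -E WA in jA.
case: (u =P w) => [_ E|_ gu]; first by rewrite -E XA in jA.
by apply: (fj u vu); rewrite gnA // gu.
Qed.

(* Exchanging [w] with [y1] keeps all accessible classes accessible, and makes
   the class of [y2] accessible since [y2] can now enter [W]. *)
Lemma insertable_joined w y1 y2 : f w = W -> w != x -> ~~ movable w ->
  f y1 \notin A -> solo w y1 -> f y2 \notin A -> solo w y2 -> y1 != y2 ->
  (exists Z, [/\ Z \notin A, nonadj e f w Z & connect arc Z (f y1)]) \/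
    (forall u, e w u -> f u = f y1 -> u = y1) ->
  e y1 y2.
Proof.
move=> fw wx nmw y1A /soloP s1 y2A /soloP s2 y12 ins; apply: contraT => ny12.
(* [Z] is to receive [w]: either a class without neighbours of [w], which a shift towards the class
   of [y1] relieves of one vertex, or the class of [y1] itself. *)
have [Z [g [ZA pg [gA gB] [gy1 gZ] gc]]] : exists Z g, [/\ Z \notin A, proper_col e g,
    (forall v, f v \in A -> g v = f v) /\ (forall v, f v \notin A -> g v \notin A),
    g y1 = f y1 /\ (forall u, e w u -> g u = Z -> u = y1) &
    forall c, #|cls g c| + (c == Z) = #|cls f c| + (c == f y1)].
  case: ins => [[Z [ZA /nonadjP fZ Zy]]|ins]; last by exists (f y1), f.
  have := connect_notin_acc ZA Zy.
  case/(shift_connect (A := [pred i | i \notin A]) esym eirr pf) => // g.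
  case=> pg gx [gout gin] [gst gend] gc; exists Z, g; split=> //.
  - by split=> v /= hv; [apply: gout; rewrite /= negbK|apply: gin].
  - by split; [apply: gend | move=> u wu /gst fu; case: (fZ u wu)].
have gAe u : g u \in A -> g u = f u.
  by case: (boolP (f u \in A)) => [/gA//|/gB/negbTE->].
have gw : g w = W by rewrite gA fw.
have gx : g x = f x by rewrite gA ?fx_acc.
have wy1 : w != y1 by apply: contraNneq y1A => <-; rewrite fw.
have wy2 : w != y2 by apply: contraNneq y2A => <-; rewrite fw.
have xy1 : x != y1 by apply: contraNneq y1A => <-; rewrite fx_acc.
have xy2 : x != y2 by apply: contraNneq y2A => <-; rewrite fx_acc.
have ZW : Z != W by apply: contraNneq ZA => ->.
pose g1 := recolor g y1 W; pose h := recolor g1 w Z.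
have hE u : h u = if u == w then Z else if u == y1 then W else g u by [].
have ph : proper_col e h.
  suff half u v : e u v -> (u == w) || (u == y1) -> h u != h v.
    move=> u v uv; case hu : ((u == w) || (u == y1)); first exact: half.
    case hv : ((v == w) || (v == y1)); first by rewrite eq_sym; apply: half; rewrite // esym.
    move: hu hv; rewrite !hE; do 4!case: ifP => //=; move=> *; exact: pg.
  move=> uv /orP[/eqP uE|/eqP uE]; rewrite uE in uv *; rewrite !hE eqxx.
    case: (v =P w) => [E|_]; first by rewrite E eirr in uv.
    case: (v =P y1) => [//|vy1]; apply/eqP => E; apply: vy1; apply: gZ => //.
  rewrite [y1 == w]eq_sym (negbTE wy1); case: (v =P w) => [_|vw]; first by rewrite eq_sym.
  case: (v =P y1) => [E|_]; first by rewrite E eirr in uv.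
  apply/eqP => E; apply: vw; apply: s1 => //.
  by rewrite -gAe // -E.
have bh i : #|cls h i| = s.
  have := card_cls_recolor g y1 W i; have := card_cls_recolor g1 w Z i.
  have := gc i; have := bf i.
  have -> : g1 w = W by rewrite /g1 /recolor (negbTE wy1).
  rewrite -/g1 -/h gy1; move: #|cls f i| #|cls g i| #|cls g1 i| #|cls h i| => c0 c1 c2 c3.
  by move: (i == Z : nat) (i == W : nat) (i == f y1 : nat); clear; lia.
have hx : h x = f x by rewrite hE eq_sym (negbTE wx) (negbTE xy1).
have hy2 : h y2 = g y2 by rewrite hE eq_sym (negbTE wy2) eq_sym (negbTE y12).
have freeh v j : nonadj e f v j -> j \in A -> j != W -> nonadj e h v j.
  move=> /nonadjP fj jA jW; apply/nonadjP => u vu; rewrite hE.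
  case: (u =P w) => [_ E|_]; first by rewrite -E (negbTE ZA) in jA.
  case: (u =P y1) => [_ E|_ E]; first by rewrite E eqxx in jW.
  by apply: (fj u vu); rewrite -gAe ?E.
have arch i j v : f v = i -> v != x -> v != w -> i \in A -> nonadj e f v j -> j \in A -> j != W ->
  move_arc e x h i j.
  move=> fv vx vw iA fj jA jW; apply/existsP; exists v; rewrite vx freeh // andbT hE (negbTE vw).
  have -> : (v == y1) = false by apply/eqP => E; rewrite -fv E (negbTE y1A) in iA.
  by rewrite gA fv ?eqxx.
have accW X : X \in A -> X != W -> X \in acc e x h.
  move=> XA XW; rewrite inE hx; move: (connect_terminal XA XW).
  apply: connect_sub => i j /= /and3P[/existsP[v /and3P[/eqP fv vx fj]] /andP[iA iW] /andP[jA jW]].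
  apply: connect1; apply: (arch _ _ v) => //.
  by apply: contraNneq iW => E; rewrite -fv E fw.
(* As [w] is not movable, the first arc on a path out of [W] is witnessed by another vertex, which
   stays in [W]. *)
have Wacc : W \in acc e x h.
  rewrite inE hx; case: (W =P f x) => [->|/eqP Wx]; first exact: connect0.
  move: (WA); rewrite inE => /connectP[p0 pp lp].
  case/shortenP: pp lp => p pp up _ lp.
  case: p pp up lp => [|X p] /=; first by move=> _ _ E; rewrite E eqxx in Wx.
  case/andP => /existsP[z /and3P[/eqP fz zx fX]] pp /andP[Wp _] lp.
  have XA : X \in A by rewrite inE lp; apply/connectP; exists p.
  have XW : X != W by apply: contraNneq Wp => ->; rewrite mem_head.
  have zw : z != w.
    apply: contraNneq nmw => <-; apply/existsP; exists X; by rewrite XA XW.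
  have := accW X XA XW; rewrite inE hx; apply: connect_trans; apply: connect1.
  exact: (arch _ _ z).
(* The only possible neighbour of [y2] in [W] was [w], which has left, and the newcomer [y1] is not
   adjacent to [y2]. *)
have y2acc : h y2 \in acc e x h.
  move: Wacc; rewrite !inE; apply: connect_trans; apply: connect1; apply/existsP; exists y2.
  rewrite eqxx eq_sym xy2 /=; apply/nonadjP => u yu; rewrite hE.
  case: (u =P w) => [_ E|uw]; first by rewrite E eqxx in ZW.
  case: (u =P y1) => [E|_ gu]; first by rewrite E esym (negbTE ny12) in yu.
  by apply: uw; apply: s2 => //; rewrite -gAe gu.
have y2nA : h y2 \notin A by rewrite hy2 gB.
have sub : h y2 |: A \subset acc e x h.
  apply/subsetP => i; rewrite in_setU1 => /orP[/eqP->//|iA].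
  by case: (i =P W) => [->//|/eqP iW]; exact: accW.
have := acc_max ph bh; have := subset_leq_card sub.
by rewrite cardsU1 y2nA; move: #|_| #|_|; clear; lia.
Qed.

(** * Counting solo neighbours *)

Definition outdeg w := #|[set y | e w y & f y \notin A]|.
(** For classes outside [low], and not merely outside [A], the family [above (f y)] is large and the
    core reaches the class of [y]. *)
Definition solos w := [set y | [&& e w y, f y \notin low & solo w y]].

Lemma solos_notin_acc w y : y \in solos w -> f y \notin A.
Proof. by rewrite inE => /and3P[_ yl _]; apply: contra yl => /(subsetP acc_low). Qed.

Lemma card_notin (C : {set 'I_r}) : #|[set y | f y \notin C]| = (r - #|C|) * s.
Proof.
have -> : r - #|C| = #|~: C|.
  by have := cardsC C; rewrite card_ord; move: #|C| #|~: C|; clear; lia.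
rewrite -sum1_card (partition_big f (mem (~: C))) /=; last by move=> y; rewrite !inE.
rewrite -sum_nat_const; apply: eq_bigr => i; rewrite inE => iC.
rewrite -(bf i) -sum1_card; apply: eq_bigl => y; rewrite !inE.
by case: (f y =P i) => [->|]; rewrite ?andbF // iC.
Qed.

(** For a solo [y] outside [low], the family [above (f y)] minus [A] has more than [r / 2] members,
    whereas [movable_solo] bounds it by [|A| < r / 4]. *)
Lemma movable_solos w : f w = W -> movable w -> solos w = set0.
Proof.
move=> fw mw; apply/setP => y; rewrite in_set0; apply/negP => ys.
have yA := solos_notin_acc ys.
move: ys; rewrite inE => /and3P[_ yl sy].
have := movable_solo fw mw yA sy.
have /orP[|/small_lt4r] := closed_dichotomy (fx_above (f y)) (@above_closed (f y)).
  by rewrite inE in yl; rewrite (negbTE yl).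
have := small_lt4r small_acc.
rewrite cardsD; have := subset_leq_card (subsetIr (above (f y)) A).
by move: #|_ :&: _| #|above _| #|A|; clear; lia.
Qed.

(** A vertex [y] outside [A] has a neighbour in [W]. For [y] outside [low], a unique such neighbour
    counts [y] twice, and otherwise two neighbours count it once each. *)
Lemma solo_weight y :
  (f y \notin A) + (f y \notin low) <=
  \sum_(w in cls f W) (e w y && (f y \notin A) + [&& e w y, f y \notin low & solo w y]).
Proof.
case: (boolP (f y \in A)) => yA; first by rewrite (subsetP acc_low _ yA).
have yx : y != x by apply: contraNneq yA => ->; exact: fx_acc.
have [u yu fu] := not_arc_nbr (acc_closed yA WA) erefl yx.
have uW : u \in cls f W by rewrite inE fu.
case: (boolP (f y \in low)) => yl /=.
  by rewrite (bigD1 u) //= esym yu.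
rewrite (bigD1 u) //= esym yu /=.
case su : (solo u y); first by [].
move/negbT: su; rewrite negb_forall => /existsP[v].
rewrite negb_imply => /andP[/andP[/eqP fv yv] vu].
rewrite (bigD1 v) /=; last by rewrite inE fv eqxx.
by rewrite esym yv /=; move: (\sum_(_ | _) _); case: (solo v y); clear; lia.
Qed.

(** By [solo_weight], [outdeg w + |solos w|] is on average at least [Y] over [W]. It is at most
    [r < Y] for [x] and for movable vertices, and [W] contains one of these, so some other vertex
    exceeds [Y]. *)
Lemma exists_heavy : exists w, [/\ f w = W, w != x, ~~ movable w &
  (r - #|A|) + (r - #|low|) < outdeg w + #|solos w|].
Proof.
set Y := _ + _.
have rY : r < Y.
  rewrite /Y; move: (small_lt4r small_acc) (small_lt4r small_low).
  by move: #|A| #|low|; clear; lia.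
pose F w := outdeg w + #|solos w|.
have [//|none] := pselect (exists w, [/\ f w = W, w != x, ~~ movable w & Y < F w]).
exfalso.
have outr w : outdeg w <= r.
  apply: leq_trans (hdeg w); apply/subset_leq_card/subsetP => y.
  by rewrite !inE => /andP[].
have Fmov w : f w = W -> movable w -> F w < Y.
  by move=> fw mw; rewrite /F movable_solos // cards0 addn0; apply: leq_ltn_trans rY.
have Fx : F x < Y.
  rewrite /F /outdeg /solos.
  have -> : [set y | e x y & f y \notin A] = set0 by apply/setP => y; rewrite !inE ex0.
  have -> : [set y | [&& e x y, f y \notin low & solo x y]] = set0.
    by apply/setP => y; rewrite !inE ex0.
  by rewrite cards0 addn0; apply: leq_ltn_trans rY.
have FY w : f w = W -> F w <= Y.
  move=> fw; case: (w =P x) => [->|/eqP wx]; first exact: ltnW.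
  case: (boolP (movable w)) => mw; first exact/ltnW/Fmov.
  by rewrite leqNgt; apply/negP => h; apply: none; exists w.
(* If [W] is not the class of [x], the witness of the first arc on a path out of [W] is movable. *)
have [z fz Fz] : exists2 z, f z = W & F z < Y.
  case: (W =P f x) => [Wx|/eqP Wx]; first by exists x.
  move: (WA); rewrite inE => /connectP[p0 pp lp].
  case/shortenP: pp lp => p pp up _ lp.
  case: p pp up lp => [|X p] /=; first by move=> _ _ E; rewrite E eqxx in Wx.
  case/andP => /existsP[z /and3P[/eqP fz zx fX]] pp /andP[Wp _] lp.
  exists z => //; apply: Fmov => //; apply/existsP; exists X; rewrite fX andbT.
  rewrite inE lp; apply/andP; split; first by apply/connectP; exists p.
  by apply: contraNneq Wp => ->; rewrite mem_head.
have up : \sum_(w in cls f W) F w < Y * s.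
  rewrite (bigD1 z) /=; last by rewrite inE fz.
  have -> : Y * s = Y + \sum_(w in cls f W | w != z) Y.
    by rewrite -(bf W) mulnC -sum_nat_const (bigD1 z) //= inE fz.
  rewrite -addSn; apply: leq_add => //; apply: leq_sum => w; rewrite inE => /andP[/eqP fw _].
  exact: FY.
have lo : Y * s <= \sum_(w in cls f W) F w.
  rewrite /Y mulnDl -!card_notin !card_set_sum -big_split /=.
  have -> : \sum_(w in cls f W) F w = \sum_y \sum_(w in cls f W)
      (e w y && (f y \notin A) + [&& e w y, f y \notin low & solo w y]).
    rewrite exchange_big /=; apply: eq_bigr => w _.
    by rewrite big_split /= /F /outdeg /solos !card_set_sum.
  by apply: leq_sum => y _; exact: solo_weight.
by move: (leq_ltn_trans lo up); rewrite ltnn.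
Qed.

Lemma outdeg_nonmovable w : f w = W -> ~~ movable w -> outdeg w + #|A| <= r.+1.
Proof.
move=> fw nmw.
have inA : #|A :\ W| <= #|[set y | e w y & f y \in A]|.
  apply: leq_trans (leq_imset_card f _); apply/subset_leq_card/subsetP => X.
  rewrite in_setD1 => /andP[XW XA].
  have [|u wu fu] := @not_nonadjP _ _ e f w X.
    by apply: contra nmw => fX; apply/existsP; exists X; rewrite XA XW.
  by apply/imsetP; exists u; rewrite // inE wu fu.
have := hdeg w; rewrite -(cardsID [set y | f y \in A]).
have -> : [set u | e w u] :&: [set y | f y \in A] = [set y | e w y & f y \in A].
  by apply/setP => y; rewrite !inE.
have -> : [set u | e w u] :\: [set y | f y \in A] = [set y | e w y & f y \notin A].
  by apply/setP => y; rewrite !inE andbC.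
have := cardsD1 W A; rewrite WA; move: inA; rewrite -/(outdeg w).
by move: #|A| #|_| #|_| (outdeg w); clear; lia.
Qed.

(** Count inside [S]: each of the [|M| + 1] vertices of [M'] is adjacent to all the rest of [S], and
    each other vertex at least to all of [M']. *)
Lemma joined_density w (M : {set T}) : f w = W -> M \subset solos w ->
  (forall y1 y2, y1 \in M -> y2 \in solos w -> y1 != y2 -> e y1 y2) ->
  (((#|M| + 1) * (2 * #|solos w| - #|M|))%:R <= 2 * m1 * (#|solos w| + 1)%:R :> R)%R.
Proof.
move=> fw Ms hM; pose S := w |: solos w; pose M' := w |: M.
have wS : w \notin solos w by rewrite inE fw (subsetP acc_low _ WA) andbF.
have wM : w \notin M by apply: contra wS => /(subsetP Ms).
have cS : #|S| = #|solos w| + 1 by rewrite cardsU1 wS addnC.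
have cM : #|M'| = #|M| + 1 by rewrite cardsU1 wM addnC.
have M'S : M' \subset S by apply: setUS.
have ws y : y \in solos w -> e w y by rewrite inE => /andP[].
have join u v : u \in M' -> v \in S -> u != v -> e u v.
  rewrite !in_setU1 => /orP[/eqP->|uM] /orP[/eqP->|vS]; rewrite ?eqxx // => uv.
  - exact: ws.
  - by rewrite esym; apply/ws/(subsetP Ms).
  - exact: hM.
apply: le_trans (_ : _ <= (edge_count e S S)%:R)%R _; last by rewrite -cS; exact: hdens.
rewrite ler_nat.
have Mle := subset_leq_card Ms.
have -> : (#|M| + 1) * (2 * #|solos w| - #|M|) =
    \sum_(u in S) if u \in M' then #|solos w| else #|M| + 1.
  rewrite (bigID (mem M')) /=.
  rewrite (eq_bigr (fun=> #|solos w|)); last by move=> u /andP[_ ->].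
  rewrite [X in _ = _ + X](eq_bigr (fun=> #|M| + 1)); last by move=> u /andP[_ /negbTE->].
  rewrite !sum_nat_const.
  have -> : #|[pred u | (u \in S) && (u \in M')]| = #|M| + 1.
    by rewrite -cM; apply: eq_card => u; rewrite inE; apply: andb_idl; exact: (subsetP M'S u).
  have -> : #|[pred u | (u \in S) && (u \notin M')]| = #|solos w| - #|M|.
    have -> : #|[pred u | (u \in S) && (u \notin M')]| = #|S :\: M'|.
      by apply: eq_card => u; rewrite inE in_setD andbC.
    by rewrite cardsDS // cS cM subnDr.
  move: Mle; move: #|M| #|solos w|; clear; nia.
apply: leq_sum => u uS; case: ifP => uM.
  have -> : #|solos w| = #|S :\ u|.
    by have := cardsD1 u S; rewrite uS cS; move: #|_| #|_|; clear; lia.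
  rewrite -sum1_card [X in _ <= X](bigID (fun v => v != u)) /=.
  apply: leq_trans (leq_addr _ _).
  rewrite (eq_bigl (fun v => (v \in S) && (v != u))); last by move=> v; rewrite in_setD1 andbC.
  by apply: leq_sum => v /andP[vS vu]; rewrite join // eq_sym.
rewrite -cM -sum1_card [X in _ <= X](bigID (mem M')) /=.
apply: leq_trans (leq_addr _ _).
rewrite [X in _ <= X](eq_bigl (mem M')); last first.
  by move=> v /=; apply: andb_idl; exact: (subsetP M'S v).
by apply: leq_sum => v vM; rewrite esym join //; apply: contraFneq uM => <-.
Qed.

(** These [y] meet the second alternative of [insertable_joined]. *)
Definition mutual w := [set y in solos w | [forall u, e w u && (f u == f y) ==> (u == y)]].

(** Give each neighbour of [w] weight one, plus one if not in [solos w], plus one if in [mutual w].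
    A neighbour of weight one is solo but not mutual, so [w] has another neighbour in that class.
    Hence each class of [K] has weight at least two, while the total is at most
    [2 outdeg w - |solos w| + |mutual w|]. *)
Lemma card_mutual (K : {set 'I_r}) w : [disjoint K & low] ->
  (forall i, i \in K -> ~~ nonadj e f w i) ->
  2 * #|K| + #|solos w| <= 2 * outdeg w + #|mutual w|.
Proof.
move=> dK hK.
pose q y := e w y + (e w y && (y \notin solos w)) + (y \in mutual w).
have KA y : f y \in K -> f y \notin A.
  move=> yK; apply: contraL yK => /(subsetP acc_low) yl.
  by move/pred0P: dK => /(_ (f y)) /=; rewrite yl andbT => ->.
have two i : i \in K -> 2 <= \sum_(y | f y == i) q y.
  move=> iK; have [y wy fy] := not_nonadjP (hK i iK).
  rewrite (bigD1 y) /=; last by rewrite fy.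
  rewrite {1}/q wy /=; case ys : (y \in solos w) => //=.
  case ym : (y \in mutual w) => //=.
  move: ym; rewrite inE ys /= => /negbT; rewrite negb_forall => /existsP[u].
  rewrite negb_imply => /andP[/andP[wu /eqP fu] uy].
  rewrite (bigD1 u) /=; last by rewrite fu fy eqxx.
  by rewrite {1}/q wu /= !addnA !add1n.
have : 2 * #|K| <= \sum_(y | f y \in K) q y.
  rewrite (partition_big f (mem K)) //= mulnC -sum_nat_const; apply: leq_sum => i iK.
  apply: leq_trans (two i iK) _; apply: eq_leq; apply: eq_bigl => y.
  by case: (f y =P i) => [->|]; rewrite ?andbF // iK.
rewrite big_mkcond /= => h.
have cE (B : {set T}) : #|B| = \sum_y (y \in B) by rewrite -sum1_card big_mkcond.
rewrite /outdeg card_set_sum (cE (solos w)) (cE (mutual w)).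
apply: leq_trans (leq_add h (leqnn _)) _.
rewrite big_distrr /= -!big_split /=; apply: leq_sum => y _.
case ys : (y \in solos w); rewrite /q ys.
  have yA := solos_notin_acc ys; have wy : e w y by move: ys; rewrite inE => /andP[].
  by rewrite yA wy; case: ifP => _; case: (y \in mutual w).
have -> : (y \in mutual w) = false by rewrite inE ys.
by case: ifP => [/KA ->|_]; case: (e w y).
Qed.

Lemma terminal_contradiction : False.
Proof.
have [w [fw wx nmw]] := exists_heavy.
have [K [dK sK reach]] := exists_core.
have ow := outdeg_nonmovable fw nmw => hw.
have a0 : 0 < #|A| by apply/card_gt0P; exists W.
have Al := subset_leq_card acc_low.
have Kl : #|K| + #|low| <= r.
  rewrite -[X in _ <= X]card_ord -(cardsC K) leq_add2l; apply: subset_leq_card.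
  by rewrite subsetC disjoints_subset in dK *.
have KA i : i \in K -> i \notin A.
  move=> iK; apply: contraL iK => /(subsetP acc_low) il.
  by move/pred0P: dK => /(_ i) /=; rewrite il andbT => ->.
have sK' : #|K| <= #|solos w|.
  move: ow hw a0 Al Kl; move: (outdeg w) #|solos w| #|A| #|low| #|K|; clear; lia.
have [M [Ms Mj Mc]] : exists M : {set T}, [/\ M \subset solos w,
    (forall y1 y2, y1 \in M -> y2 \in solos w -> y1 != y2 -> e y1 y2) &
    r <= #|M| + 3 * (r - #|K|)].
  (* If [w] has no neighbour in some core class [Z], every solo neighbour qualifies, since [Z]
     reaches its class. Otherwise the mutual ones qualify, and [card_mutual] provides enough of
     them. *)
  case: (pickP [pred Z | (Z \in K) && nonadj e f w Z]) => [Z /andP[ZK fZ]|none].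
    exists (solos w); split=> //; last first.
      by move: sK' Kl; move: #|solos w| #|low| #|K|; clear; lia.
    move=> y1 y2 y1s y2s y12; have := solos_notin_acc y1s; have := solos_notin_acc y2s.
    move: y1s y2s; rewrite !inE -!/low => /and3P[_ y1l s1] /and3P[_ y2l s2] y2A y1A.
    apply: (insertable_joined fw) => //; rewrite ?inE //; left; exists Z; split=> //.
      exact: KA.
    by apply: reach => //; rewrite inE.
  exists (mutual w); split.
  - by apply/subsetP => y; rewrite inE => /andP[].
  - move=> y1 y2; rewrite inE => /andP[y1s /forallP mu] y2s y12.
    have := solos_notin_acc y1s; have := solos_notin_acc y2s.
    move: y1s y2s; rewrite !inE => /and3P[_ y1l s1] /and3P[_ y2l s2] y2A y1A.
    apply: (insertable_joined fw) => //; rewrite ?inE //; right => u wu fu.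
    by apply/eqP; apply: (implyP (mu u)); rewrite wu fu eqxx.
  - have nz i : i \in K -> ~~ nonadj e f w i.
      by move=> iK; have := none i; rewrite /= iK => /negbT.
    have := card_mutual dK nz; move: ow hw a0 Al Kl.
    by move: (outdeg w) #|solos w| #|A| #|low| #|K| #|_|; clear; lia.
apply: (joined_density_contradiction hb1 hb2 hr _ sK _ Mc _ (joined_density fw Ms Mj)).
- by move: a0 Al Kl; move: #|A| #|low| #|K|; clear; lia.
- by move: sK'; move: #|solos w| #|K|; clear; lia.
- exact: subset_leq_card.
Qed.

End Terminal.

Lemma maximal_acc_contradiction : False.
Proof.
have [W [WA Wt Wr]] := exists_terminal arc (f x).
apply: (@terminal_contradiction W); first by rewrite inE.
- by move=> X; rewrite inE; exact: Wt.
- by move=> E X; rewrite inE; exact: Wr.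
Qed.

End MaximalAccessible.

(** * Sparse graphs and balanced colorings *)

(** The hypotheses in a form that passes to subgraphs and to the sum with a suitable clique. Ordered
    pairs inside [S] are counted, hence the bound [2 m1]. *)
Definition sparse (R : realFieldType) (m1 m2 : R) (r : nat) (T : finType) (e : rel T) : Prop :=
  [/\ symmetric e, irreflexive e, forall v, #|[set u | e v u]| <= r,
      forall S, ((edge_count e S S)%:R <= 2 * m1 * #|S|%:R :> R)%R &
      forall A B : {set T}, [disjoint A & B] ->
        ((edge_count e A B)%:R <= m2 * (#|A| + #|B|)%:R :> R)%R].

Lemma sparse_subrel (R : realFieldType) (m1 m2 : R) r (T : finType) (e e' : rel T) :
  symmetric e' -> subrel e' e -> sparse m1 m2 r e -> sparse m1 m2 r e'.
Proof.
move=> esym' sub [esym eirr hdeg h1 h2].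
have le A B : ((edge_count e' A B)%:R <= (edge_count e A B)%:R :> R)%R.
  rewrite ler_nat; apply: leq_sum => u _; apply: leq_sum => v _.
  by case h : (e' u v) => //; rewrite (sub _ _ h).
split=> //.
- by move=> u; apply: contraFF (eirr u); exact: sub.
- move=> v; apply: leq_trans (hdeg v); apply/subset_leq_card/subsetP => u.
  by rewrite !inE; exact: sub.
- by move=> S; apply: le_trans (le S S) (h1 S).
- by move=> A B dAB; apply: le_trans (le A B) (h2 A B dAB).
Qed.

Lemma exists_low_degree (R : realFieldType) (m1 m2 : R) r (T : finType) (e : rel T) (S : {set T}) :
  sparse m1 m2 r e -> S != set0 ->
  exists2 x, x \in S & (#|[set u in S | e x u]|%:R <= 2 * m1)%R.
Proof.
case=> _ _ _ h1 _ /set0Pn[x0 x0S].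
case: (@arg_minnP _ x0 (mem S) (fun x => #|[set u in S | e x u]|) x0S) => x xS xmin.
exists x => //.
have S0 : (0 < #|S|%:R :> R)%R by rewrite ltr0n; apply/card_gt0P; exists x.
rewrite -(ler_pM2r S0) -natrM; apply: le_trans (h1 S); rewrite ler_nat mulnC -sum_nat_const.
apply: leq_sum => u uS; apply: leq_trans (xmin u uS) _.
rewrite card_set_sum [X in _ <= X]big_mkcond /=; apply: eq_leq; apply: eq_bigr => v _.
by case: (v \in S).
Qed.

Lemma exists_balanced_map (T : finType) (r s : nat) : #|T| = r * s ->
  exists f : T -> 'I_r, forall i, #|cls f i| = s.
Proof.
move=> cT.
have E : #|T| = #|{: 'I_r * 'I_s}| by rewrite card_prod !card_ord.
pose h (v : T) : 'I_r * 'I_s := enum_val (cast_ord E (enum_rank v)).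
have bij : bijective h.
  exists (fun p => enum_val (cast_ord (esym E) (enum_rank p))) => v.
    by rewrite /h enum_valK cast_ordK enum_rankK.
  by rewrite /h enum_valK cast_ordKV enum_rankK.
exists (fun v => (h v).1) => i.
pose D := [set p : 'I_r * 'I_s | p.1 == i].
have -> : cls (fun v => (h v).1) i = h @^-1: D by apply/setP => v; rewrite !inE.
rewrite on_card_preimset; last exact: onW_bij.
have -> : D = [set (i, j) | j in [set: 'I_s]].
  apply/setP => -[a b]; rewrite inE /=; apply/eqP/imsetP => [->|[j _ [->]]//].
  by exists b; rewrite ?inE.
by rewrite card_imset ?cardsT ?card_ord // => a b [].
Qed.

Section Coloring.
Variables (R : realFieldType) (m1 m2 beta : R) (r : nat).
Hypotheses (hm2 : (0 < m2)%R) (hm12 : (m1 <= (18%:R / 10%:R) * m2)%R).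
Hypotheses (hb1 : (1 / 2%:R <= beta)%R) (hb2 : (beta < 1)%R).
Hypothesis hroot :
  (2%:R * m2 * (1 - beta) * (1 + beta) ^+ 2 - m1 * beta * (2%:R + beta) = 0)%R.
Hypothesis hr : (2 * m1 <= (1 - beta) * r%:R)%R.
Hypothesis r0 : 0 < r.

Section PlaceVertex.
Variables (T : finType) (s : nat) (e : rel T) (x : T) (N : {set T}).
Hypotheses (he : sparse m1 m2 r e) (ex0 : forall u, e x u = false).
Hypotheses (xN : x \notin N) (hN : (#|N|%:R <= 2 * m1)%R).

(** Here [x] is isolated in [e], and [N] holds the neighbours it will receive. If [N] misses an
    accessible class, a shift makes room for [x] there. Otherwise the number of accessible classes
    is at most [|N| <= 2 m1 <= r / 2], so by [maximal_acc_contradiction] it was not maximal. *)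
Lemma place_or_improve (f : T -> 'I_r) :
  proper_col e f -> (forall i, #|cls f i| = s) ->
  (exists g : T -> 'I_r, [/\ proper_col e g, (forall i, #|cls g i| = s) &
    forall u, u \in N -> g u != g x]) \/
  (exists g : T -> 'I_r, [/\ proper_col e g, (forall i, #|cls g i| = s) &
    #|acc e x f| < #|acc e x g|]).
Proof.
move=> pf bf; case: (he) => esym eirr hdeg h1 h2.
case: (boolP [exists i in acc e x f, [forall u in N, f u != i]]) => [|no].
  case/exists_inP => i; rewrite inE => ci /forall_inP hi; left.
  have [|//|g [pg gx _ [gst gend] gc]] :=
    @shift_connect _ _ e x esym eirr predT f i (f x) pf.
    by apply: connect_sub ci => a b ab; apply: connect1; rewrite /= ab.
  exists (recolor g x i); split.
  - by apply: recolor_proper => //; apply/nonadjP => u; rewrite ex0.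
  - move=> c; have := card_cls_recolor g x i c; have := gc c; rewrite gx bf.
    by move: #|_| #|_| (c == i : nat) (c == f x : nat); clear; lia.
  - move=> u uN; rewrite /recolor eqxx; case: (u =P x) => [E|_]; first by move: xN; rewrite -E uN.
    by apply/eqP => /gst fu; have := hi u uN; rewrite fu eqxx.
right.
have half : 2 * #|acc e x f| <= r.
  apply: (double_le_of_le_2m1 hb1 hr); apply: le_trans hN; rewrite ler_nat.
  apply: leq_trans (leq_imset_card f _); apply/subset_leq_card/subsetP => i iA.
  move: no; rewrite negb_exists => /forallP /(_ i); rewrite iA /= negb_forall => /existsP[u].
  by rewrite negb_imply negbK => /andP[uN /eqP <-]; exact: imset_f.
apply: contrapT => nog.
apply: (maximal_acc_contradiction hm2 hb1 hb2 hroot hr esym eirr ex0 hdeg h1 h2 pf bf half).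
by move=> g pg bg; rewrite leqNgt; apply/negP => hg; apply: nog; exists g.
Qed.

Lemma place_vertex (f : T -> 'I_r) : proper_col e f -> (forall i, #|cls f i| = s) ->
  exists g : T -> 'I_r, [/\ proper_col e g, (forall i, #|cls g i| = s) &
    forall u, u \in N -> g u != g x].
Proof.
have [k] := ubnP (r - #|acc e x f|); elim: k f => // k IH f hk pf bf.
have [//|[g [pg bg hg]]] := place_or_improve pf bf.
apply: (IH g) => //; have := max_card (mem (acc e x g)); rewrite card_ord.
by move: hk hg; move: #|acc e x f| #|acc e x g|; clear; lia.
Qed.

End PlaceVertex.

Lemma balanced_coloring (T : finType) (s : nat) (e : rel T) : #|T| = r * s ->
  sparse m1 m2 r e ->
  exists f : T -> 'I_r, proper_col e f /\ forall i, #|cls f i| = s.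
Proof.
move=> cT he; case: (he) => esym eirr _ _ _.
(* Only edges inside the active set are kept, so a vertex about to be activated is isolated so
   far. *)
pose restr (S : {set T}) := [rel u v | [&& e u v, u \in S & v \in S]].
have sub S : subrel (restr S) e by move=> u v /andP[].
have rsym S : symmetric (restr S) by move=> u v /=; rewrite esym [(u \in S) && _]andbC.
suff main n (S : {set T}) : #|S| = n ->
    exists f : T -> 'I_r, proper_col (restr S) f /\ forall i, #|cls f i| = s.
  have [f [pf bf]] := main _ [set: T] erefl; exists f; split=> // u v uv.
  by apply: pf; rewrite /= uv !inE.
elim: n S => [|n IH] S cS.
  have [f bf] := exists_balanced_map cT; exists f; split=> // u v.
  by move/eqP: cS; rewrite cards_eq0 => /eqP ->; rewrite /= !inE !andbF.
have S0 : S != set0 by rewrite -cards_eq0 cS.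
have [x xS dx] := exists_low_degree he S0.
have [|f [pf bf]] := IH (S :\ x); first by have := cardsD1 x S; rewrite xS cS; lia.
have [|||g [pg bg hg]] := @place_vertex T s (restr (S :\ x)) x [set u in S | e x u] _ _ _ dx f pf bf.
- exact: sparse_subrel he.
- by move=> u; rewrite /= !inE eqxx andbF.
- by rewrite !inE eirr andbF.
exists g; split=> // u v /and3P[uv uS vS].
case: (u =P x) => [ux|/eqP ux]; first by rewrite eq_sym ux; apply: hg; rewrite inE vS -ux.
case: (v =P x) => [vx|/eqP vx]; first by rewrite vx; apply: hg; rewrite inE uS -vx esym.
by apply: pg; rewrite /= uv !in_setD1 ux vx uS vS.
Qed.

(** * Orders that [r] does not divide *)

Lemma sparse_relpre (T T' : finType) (h : T' -> T) (e : rel T) : injective h ->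
  sparse m1 m2 r e -> sparse m1 m2 r (relpre h e).
Proof.
move=> hinj [esym eirr hdeg h1 h2].
have cE (A B : {set T'}) : edge_count (relpre h e) A B = edge_count e (h @: A) (h @: B).
  rewrite /edge_count big_imset /=; last by move=> ? ? _ _; exact: hinj.
  apply: eq_bigr => u _; rewrite big_imset //=; by move=> ? ? _ _; exact: hinj.
split.
- by move=> u v; exact: esym.
- by move=> u; exact: eirr.
- move=> v; apply: leq_trans (hdeg (h v)); rewrite -(card_imset _ hinj).
  by apply/subset_leq_card/subsetP => _ /imsetP[u ue ->]; rewrite !inE in ue *.
- by move=> S; rewrite cE -(card_imset _ hinj).
- move=> A B dAB; rewrite cE -(card_imset A hinj) -(card_imset B hinj); apply: h2.
  apply/pred0P => v /=; apply/negbTE/negP => /andP[/imsetP[a aA ->] /imsetP[b bB /hinj E]].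
  by move/pred0P: dAB => /(_ a) /=; rewrite aA E bB.
Qed.

Definition add_clique (T : finType) (p : nat) (e : rel T) : rel (T + 'I_p) :=
  fun a b => match a, b with
             | inl u, inl v => e u v
             | inr i, inr j => i != j
             | _, _ => false
             end.

(** Degrees inside the clique are below [p < 2 m1]. The bipartite bound needs [p <= 4 m2], which
    holds as [2 m1 <= 3.6 m2]; this is where [m1 <= 1.8 m2] enters. *)
Lemma sparse_add_clique (T : finType) (p : nat) (e : rel T) :
  (p.+1%:R <= 2 * m1)%R -> p <= r -> sparse m1 m2 r e -> sparse m1 m2 r (@add_clique T p e).
Proof.
move=> hp pr [esym eirr hdeg h1 h2].
pose L (S : {set T + 'I_p}) := [set u | inl u \in S].
pose I (S : {set T + 'I_p}) := [set i | inr i \in S].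
have cS (S : {set T + 'I_p}) : #|S| = #|L S| + #|I S|.
  by rewrite -sum1_card big_sumType /= !sum1_card !cardsE.
have cE (A B : {set T + 'I_p}) : edge_count (@add_clique T p e) A B =
    edge_count e (L A) (L B) + \sum_(i in I A) \sum_(j in I B) (i != j).
  rewrite /edge_count big_sumType /=; congr (_ + _).
    rewrite [RHS]big_mkcond [LHS]big_mkcond /=; apply: eq_bigr => u _; rewrite inE.
    case: (_ \in A) => //; rewrite big_sumType /= [X in _ + X]big1 ?addn0 //.
    by rewrite [RHS]big_mkcond [LHS]big_mkcond /=; apply: eq_bigr => v _; rewrite inE.
  rewrite [RHS]big_mkcond [LHS]big_mkcond /=; apply: eq_bigr => u _; rewrite inE.
  case: (_ \in A) => //; rewrite big_sumType /= [X in X + _]big1 ?add0n //.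
  by rewrite [RHS]big_mkcond [LHS]big_mkcond /=; apply: eq_bigr => v _; rewrite inE.
have Ip (S : {set T + 'I_p}) : #|I S| <= p by rewrite -[X in _ <= X]card_ord max_card.
split.
- by move=> [u|i] [v|j] //=; rewrite eq_sym.
- by move=> [u|i] /=; rewrite ?eqxx.
- move=> [u|i]; rewrite cS.
    have -> : I [set b | add_clique e (inl u) b] = set0 by apply/setP => j; rewrite !inE.
    rewrite cards0 addn0; apply: leq_trans (hdeg u); apply/subset_leq_card/subsetP => v.
    by rewrite !inE.
  have -> : L [set b | add_clique e (inr i) b] = set0 by apply/setP => j; rewrite !inE.
  by rewrite cards0 add0n; apply: leq_trans pr.
- move=> S; rewrite cE cS !natrD mulrDr; apply: lerD; first exact: h1.
  apply: (@le_trans _ _ (p%:R * #|I S|%:R)%R).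
    rewrite -natrM ler_nat mulnC -sum_nat_const; apply: leq_sum => i _.
    apply: leq_trans (Ip S); rewrite -sum1_card; apply: leq_sum => j _.
    by case: (_ != _).
  by apply: ler_wpM2r => //; move: hp; rewrite -natr1; lra.
- move=> A B dAB; rewrite cE !cS.
  have dL : [disjoint L A & L B].
    by apply/pred0P => u /=; rewrite !inE; move/pred0P: dAB => /(_ (inl u)).
  have dI : [disjoint I A & I B].
    by apply/pred0P => u /=; rewrite !inE; move/pred0P: dAB => /(_ (inr u)).
  have -> : #|L A| + #|I A| + (#|L B| + #|I B|) = #|L A| + #|L B| + (#|I A| + #|I B|).
    by rewrite addnACA.
  rewrite natrD [in leRHS]natrD mulrDr; apply: lerD; first exact: h2.
  have cI : #|I A| + #|I B| <= p.
    rewrite -[X in _ <= X]card_ord.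
    rewrite -[X in X <= _]subn0 -(@cards0 'I_p) -(disjoint_setI0 dI) -cardsU.
    exact: max_card.
  apply: (@le_trans _ _ (#|I A| * #|I B|)%:R%R).
    rewrite ler_nat -sum_nat_const; apply: leq_sum => i _.
    by rewrite -sum1_card; apply: leq_sum => j _; case: (_ != _).
  move: cI; rewrite -(ler_nat R) natrM !natrD.
  have := ler0n R #|I A|; have := ler0n R #|I B|.
  move: (#|I A|%:R)%R (#|I B|%:R)%R hp hm12 => a b hp h12 a0 b0 ab.
  move: hp; rewrite -natr1 => hp.
  (* AM-GM: [a b <= (a + b)^2 / 4 <= (a + b) p / 4] *)
  have ag : (0 <= (a - b) * (a - b))%R by rewrite -expr2 sqr_ge0.
  have : (0 <= (a + b) * (p%:R - (a + b)))%R by apply: mulr_ge0; lra.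
  have : (0 <= (a + b) * (4 * m2 - p%:R))%R by apply: mulr_ge0; have := hm2; lra.
  lra.
Qed.

Lemma equitable_map (T : finType) (e : rel T) : sparse m1 m2 r e ->
  exists f : T -> 'I_r, proper_col e f /\
    forall i, #|T| %/ r <= #|cls f i| <= (#|T| %/ r).+1.
Proof.
have [n] := ubnP #|T|; elim: n T e => // n IH T e cT he.
case: (he) => esym eirr hdeg _ _.
set q := #|T| %/ r.
have Tq : #|T| = q * r + #|T| %% r by exact: divn_eq.
have rho := ltn_pmod #|T| r0.
case: (posnP (#|T| %% r)) => [rho0|rho0].
  have [|f [pf bf]] := @balanced_coloring T q e _ he; first by rewrite Tq rho0 addn0 mulnC.
  by exists f; split=> // i; rewrite bf leqnn leqnSn.
pose p := r - #|T| %% r.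
case: (lerP (p.+1%:R) (2 * m1))%R => hp.
  have [||f [pf bf]] := @balanced_coloring (T + 'I_p)%type q.+1 (@add_clique T p e).
  - by rewrite card_sum card_ord {1}Tq /p mulnS; move: rho; clear; lia.
  - by apply: sparse_add_clique => //; exact: leq_subr.
  exists (fun u => f (inl u)); split; first by move=> u v uv; apply: pf.
  (* Clique vertices have distinct colors, so dropping them costs each class at most one vertex. *)
  move=> i; have := bf i.
  have -> : #|cls f i| = #|cls (fun u => f (inl u)) i| + #|[set j | f (inr j) == i]|.
    rewrite /cls -!sum1_card big_sumType /=.
    by congr (_ + _); apply: eq_bigl => v; rewrite !inE.
  have : #|[set j | f (inr j) == i]| <= 1.
    apply/card_le1P => j; rewrite inE => /eqP fj k; rewrite !inE.
    apply/eqP/eqP => [fk|->//]; apply/eqP; apply: contraT => kj.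
    by have := pf (inr k) (inr j) kj; rewrite fk fj eqxx.
  by move: #|_| #|_|; clear; lia.
have T0 : [set: T] != set0.
  by rewrite -cards_eq0 cardsT -lt0n Tq; move: rho0; clear; lia.
have [x _ dx] := exists_low_degree he T0.
pose U := {v : T | v != x}.
have cU : #|{: U}|.+1 = #|T|.
  by rewrite card_sig cardC1 prednK //; apply/card_gt0P; exists x.
have qU : #|{: U}| = q * r + (#|T| %% r).-1 by move: cU Tq rho0; clear; lia.
have [|f [pf]] := IH U _ _ (sparse_relpre (@val_inj _ _ U) he).
  by move: cT; rewrite -cU.
have -> : #|{: U}| %/ r = q.
  by rewrite qU divnMDl // divn_small ?addn0 //; move: rho; clear; lia.
(* Without [x], exactly [p + 1] classes have size [q]. As [x] has at most [p] neighbours, one of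
   these classes can take [x]. *)
move=> bf; pose big := [set i | #|cls f i| == q.+1].
have cbig : #|big| = (#|T| %% r).-1.
  suff : #|{: U}| = q * r + #|big| by rewrite qU; move: #|big|; clear; lia.
  rewrite -(sum_card_cls f) -[X in q * X]card_ord mulnC -sum_nat_const.
  rewrite /big card_set_sum -big_split /=; apply: eq_bigr => i _.
  move: (bf i); move: #|cls f i| => k; clear; case: eqP; lia.
pose nbr := [set u : U | e x (val u)].
have cnbr : #|f @: nbr| <= p.
  apply: leq_trans (leq_imset_card f nbr) _; rewrite -ltnS -(ltr_nat R).
  apply: le_lt_trans hp; apply: le_trans dx; rewrite ler_nat -(card_imset _ (@val_inj _ _ U)).
  by apply/subset_leq_card/subsetP => _ /imsetP[u un ->]; rewrite !inE in un *.
have [c cb cn] : exists2 c, c \notin big & c \notin f @: nbr.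
  have : ~~ (~: big \subset f @: nbr).
    apply/negP => /subset_leq_card; have := cardsC big; rewrite card_ord cbig.
    move: cnbr rho rho0; rewrite /p; move: (#|T| %% r) #|~: big| #|f @: nbr|; clear; lia.
  by case/subsetPn => c; rewrite inE; exists c.
(* [insub] fails only at [x], so the default [c] is the color of [x]. *)
pose g v := if insub v is Some u then f u else c.
have gval (u : U) : g (val u) = f u by rewrite /g valK.
have gx : g x = c by rewrite /g insubF // eqxx.
have gcases v : v = x \/ exists u : U, v = val u.
  by case: (v =P x) => [->|/eqP vx]; [left | right; exists (Sub v vx); rewrite SubK].
have xc (u : U) : e x (val u) -> f u != c.
  by move=> xu; apply: contraNneq cn => <-; apply: imset_f; rewrite inE.
exists g; split.
  move=> u v; case: (gcases u) => [->|[a ->]]; case: (gcases v) => [->|[b ->]].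
  - by rewrite eirr.
  - by rewrite gx gval eq_sym; exact: xc.
  - by rewrite gx gval esym; exact: xc.
  - by rewrite !gval; exact: pf.
move=> i; have -> : #|cls g i| = (i == c) + #|cls f i|.
  rewrite (cardsD1 x) inE gx eq_sym; congr (_ + _).
  rewrite -(card_imset _ (@val_inj _ _ U)); apply: eq_card => v.
  rewrite !inE; apply/idP/imsetP => [/andP[vx]|[u]].
    by case: (gcases v) vx => [->|[u -> _]]; rewrite ?eqxx // gval => fu; exists u; rewrite ?inE.
  by rewrite inE => fu ->; rewrite gval fu (valP u).
case: (i =P c) => [->|_]; last exact: bf.
move: (bf c) cb; rewrite inE; move: #|cls f c|; clear; lia.
Qed.

End Coloring.

(** * From the maximum degree to the bound on [r] *)

Local Open Scope ring_scope.

Theorem theorem1 (R : realType) (m1 m2 beta : R)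
  (hm1 : 0 < m1) (hm2 : 0 < m2) (hm12 : m1 <= (18%:R / 10%:R) * m2)
  (hb1 : 1 / 2%:R <= beta) (hb2 : beta < 1)
  (hroot : 2%:R * m2 * (1 - beta) * (1 + beta) ^+ 2 - m1 * beta * (2%:R + beta) = 0)
  (T : finType) (e : rel T) (hG : simple_graph e) (hclass : in_class m1 m2 e)
  (hdeg : (2%:R / (1 - beta)) * m1 <= (max_degree e)%:R) :
  forall r : nat, (max_degree e <= r)%N -> equitable_coloring e r.
Proof.
move=> r Dr; case: (hG) => esym eirr.
have b0 : 0 < 1 - beta by rewrite subr_gt0.
have hr : 2 * m1 <= (1 - beta) * r%:R.
  have Dr' : (max_degree e)%:R <= r%:R :> R by rewrite ler_nat.
  have := le_trans hdeg Dr'; rewrite -(ler_pM2l b0).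
  by rewrite !mulrA [_ * 2]mulrC mulfK ?gt_eqF.
have r0 : (0 < r)%N.
  case: r hr {Dr} => // hr; have : 0 < 2 * m1 by apply: mulr_gt0.
  by rewrite ltNge (le_trans hr) // mulr0.
have he : sparse m1 m2 r e.
  split=> // [v||].
  - by apply: leq_trans Dr; exact: (leq_bigmax (F := degree e) v).
  - exact: (in_class_density hG hclass).
  - exact: (in_class_bipartite_density hG hclass).
have [f [pf bf]] := equitable_map hm2 hm12 hb1 hb2 hroot hr r0 he.
exists f; split=> // i j; have /andP[_ fi] := bf i; have /andP[fj _] := bf j.
exact: leq_trans fi _.
Qed.
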